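(* Let $K$ be a number field with ring of integers $\mathcal{O}_K$ and let $a,b,c,d\in\mathcal{O}_K$. Let $\mathcal{G}$ be the affine plane curve $F(X,Y)=cY^4-dXY^3+bY^2+a=0$ and let $\mathcal{G}(\mathcal{O}_K)=\{(X,Y)\in\mathcal{O}_K^2 : F(X,Y)=0\}$. Assume that $\mathcal{G}(\mathcal{O}_K)$ contains a non-singular point. Then the set $\mathcal{GP}_{(a,b,c,d)}(K)$ is finite if and only if $K=\mathbb{Q}$ or $K$ is an imaginary quadratic field.
   Context: For a number field $K$ with ring of integers $\mathcal{O}_K$ and $a,b,c,d\in\mathcal{O}_K$, $\mathcal{GP}_{(a,b,c,d)}(K)$ denotes the set of non-trivial triples $(x,y,z)\in\mathcal{O}_K^3$ in geometric progression satisfying $ax^2+by^2+cz^2=dxyz$. Here $(x,y,z)$ is in geometric progression over $\mathcal{O}_K$ if there exist $\alpha,\beta\in\mathcal{O}_K$ with $x=\alpha$, $y=\alpha\beta$, $z=\alpha\beta^2$; the trivial triple, corresponding to $\alpha=0$, is $(0,0,0)$.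
   Formalization: The formal theorem also assumes that F(X,Y) is irreducible over K (given an integral point, that a and d are nonzero); otherwise the claim fails, e.g. K=Q, a=-1, b=1, c=d=0, where all (x,x,x) are solutions. *)

(* Defs.v *)
From HB Require Import structures.
From mathcomp Require Import all_boot all_order all_algebra all_field.
From mathcomp Require Import boolp classical_sets functions cardinality.

Set Implicit Arguments.
Unset Strict Implicit.
Unset Printing Implicit Defensive.

Import GRing.Theory.
Local Open Scope ring_scope.

(* Number fields are the finite extensions of Q, i.e. K : fieldExtType rat. *)

Definition algebraic_integer (K : fieldExtType rat) (x : K) : Prop :=
  integralOver (intr : int -> K) x.

Definition is_rational_field (K : fieldExtType rat) : Prop :=
  {:K}%VS = 1%VS.

(* K = Q(sqrt(-m)) for some integer m > 0. *)
Definition imaginary_quadratic (K : fieldExtType rat) : Prop :=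
  exists (m : nat) (s : K),
    [/\ (0 < m)%N, s ^+ 2 = - m%:R & <<1; s>>%VS = {:K}%VS].

(* Bivariate polynomials follow the convention of polyXY: 'X is the outer
   variable, 'Y is the inner variable 'X%:P, and u.[x, y] evaluates u at
   'X = x, 'Y = y. *)
Definition curve_poly (K : fieldExtType rat) (a b c d : K) : {poly {poly K}} :=
  let Y : {poly {poly K}} := 'X%:P in
  c%:P%:P * Y ^+ 4 - d%:P%:P * 'X * Y ^+ 3 + b%:P%:P * Y ^+ 2 + a%:P%:P.

Definition partialX (K : fieldExtType rat) (u : {poly {poly K}}) := u^`().

Definition partialY (K : fieldExtType rat) (u : {poly {poly K}}) :=
  map_poly (fun p : {poly K} => p^`()) u.

(* Irreducible element of the ring K[X, Y].  The library's irreducible_poly is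
   not suitable over the coefficient ring K[Y]: it rests on pseudo-division, so
   it ignores factors that lie in K[Y]. *)
Definition irreducible2 (K : fieldExtType rat) (u : {poly {poly K}}) : Prop :=
  [/\ u != 0, u \isn't a GRing.unit &
      forall v w : {poly {poly K}}, u = v * w ->
        v \is a GRing.unit \/ w \is a GRing.unit].

Definition integral_point (K : fieldExtType rat) (u : {poly {poly K}})
    (P : K * K) : Prop :=
  [/\ algebraic_integer P.1, algebraic_integer P.2 & u.[P.1, P.2] = 0].

Definition nonsingular_at (K : fieldExtType rat) (u : {poly {poly K}})
    (P : K * K) : Prop :=
  (partialX u).[P.1, P.2] <> 0 \/ (partialY u).[P.1, P.2] <> 0.

Definition geometric_progression (K : fieldExtType rat) (x y z : K) : Prop :=
  exists alpha beta : K,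
    [/\ algebraic_integer alpha, algebraic_integer beta,
        x = alpha, y = alpha * beta & z = alpha * beta ^+ 2].

Definition GP (K : fieldExtType rat) (a b c d : K) : set (K * K * K) :=
  [set t | let: (x, y, z) := t in
    [/\ algebraic_integer x /\ algebraic_integer y /\ algebraic_integer z,
        (x, y, z) <> (0, 0, 0),
        geometric_progression x y z &
        a * x ^+ 2 + b * y ^+ 2 + c * z ^+ 2 = d * x * y * z]]%classic.

(* Main.v *)
Require Import Defs.
From mathcomp Require Import all_boot all_order all_algebra all_field.
From mathcomp Require Import boolp classical_sets functions cardinality.
From mathcomp Require Import ring zify.

(** A geometric progression (x, x y, x y^2) with x <> 0 solves the equation
    exactly when c y^4 + b y^2 + a = d x y^3, so the set GP a b c d is in
    bijection with the integral points (x, y) of the curve with x <> 0.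
    Irreducibility of the curve together with the existence of a point on it
    forces a <> 0 and d <> 0; hence y determines x, and y divides a.

    If K is Q or imaginary quadratic, write y = u + v s with s^2 = -m <= 0.  The
    norm u^2 + m v^2 of a divisor y of a is a natural number bounded by the norm
    of a, and it bounds the trace 2 u; so y is a root of one of finitely many
    quadratic polynomials ([finite_divisors]), and GP a b c d is finite.

    Otherwise, start from an integral point (x0, y0), and choose a positive
    integer M divisible by d y0^3 in the ring of integers.  For every unit u with
    u = 1 mod M, the point with ordinate y0 u is again integral ([GP_of_unit]),
    so it suffices to find infinitely many such units
    ([infinite_units_congr1]).  This weak form of the unit theorem of Dirichlet
    is proved in an order Z[t], t an integral generator of K, of rank n.  Since K
    is neither Q nor imaginary quadratic, some root z of the minimal polynomial
    of t gives an archimedean place of degree e < n (e = 1 if z is real, e = 2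
    otherwise).  The pigeonhole principle yields nonzero elements of Z[t] that
    are arbitrarily small at z and have norm bounded by a constant C
    ([small_elements_bounded_norm]); in particular there are infinitely many
    elements of norm at most C.  Among them, two elements that are congruent
    modulo C! M have as quotient a unit congruent to 1 modulo M, because each
    divides its norm, which divides C! ([ratio_in_units_congr1]).  There are
    finitely many classes modulo C! M, so there are infinitely many units. *)

Set Implicit Arguments.
Unset Strict Implicit.
Unset Printing Implicit Defensive.

Import Order.TTheory GRing.Theory Num.Theory.
Local Open Scope ring_scope.
Local Open Scope classical_set_scope.

(** * An integral primitive element *)

(** Clearing denominators: if x is a root of the monic rational polynomial q of
    degree n and D is a common denominator of its coefficients, then D x is a
    root of the monic integer polynomial D^n q(X / D). *)
Lemma exists_int_scaled_poly (q : {poly rat}) : q \is monic ->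
  exists (D : nat) (p : {poly int}),
    [/\ (0 < D)%N, p \is monic, size p = size q &
        forall (F : fieldExtType rat) (x : F),
           root (map_poly (in_alg F) q) x ->
           root (map_poly intr p) (x *+ D)].
Proof.
move=> mq.
set n := (size q).-1.
have sq : size q = n.+1 by rewrite /n prednK // lt0n size_poly_eq0 monic_neq0.
have qn : q`_n = 1 by apply/eqP; rewrite -monicE in mq *.
pose D := (\prod_(i < n) `|denq q`_i|)%N.
have D0 : (0 < D)%N by rewrite prodn_gt0 // => i; rewrite absz_gt0 denq_neq0.
pose p := \poly_(i < n.+1) numq (D%:R ^+ (n - i) * q`_i).
have cint i : (i < n.+1)%N ->
    (numq (D%:R ^+ (n - i) * q`_i))%:~R = D%:R ^+ (n - i) * q`_i.
  rewrite ltnS leq_eqVlt => /orP[/eqP->|ltin].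
    by rewrite subnn expr0 mul1r qn.
  apply: numqK; rewrite -(subnSK ltin) exprSr -mulrA rpredM ?rpredX ?rpred_nat //.
  rewrite /D (bigD1 (Ordinal ltin)) //= natrM mulrAC.
  rewrite rpredM ?rpred_nat // mulrC.
  by rewrite pmulrn gez0_abs ?denq_ge0 // -numqE intr_int.
have sp : size p = n.+1.
  by rewrite size_poly_eq // subnn expr0 mul1r qn.
have mp : p \is monic.
  by rewrite monicE lead_coefE sp coef_poly ltnSn subnn expr0 mul1r qn.
exists D, p; split; rewrite ?sp ?sq //.
move=> F x /rootP; rewrite horner_coef size_map_poly sq => qx0.
apply/rootP; rewrite horner_coef size_map_poly_id0; last first.
  by rewrite (monicP mp) rmorph1 oner_neq0.
rewrite sp; apply: (etrans _ (mulr0 (D%:R ^+ n))).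
rewrite -[in RHS]qx0 mulr_sumr; apply: eq_bigr => i _.
rewrite !coef_map /= coef_poly ltn_ord.
rewrite -(rmorph_int (in_alg F)) /= cint // -[x *+ D]mulr_natl exprMn.
have -> : (D%:R : F) ^+ n = D%:R ^+ (n - i) * D%:R ^+ i.
  by rewrite -exprD subnK // -ltnS ltn_ord.
have -> : ((D%:R : rat) ^+ (n - i) * q`_i)%:A = D%:R ^+ (n - i) * (q`_i)%:A :> F.
  by rewrite -[LHS]/(in_alg F _) rmorphM rmorphXn rmorph_nat.
by rewrite -!mulrA; congr (_ * _); rewrite mulrCA.
Qed.

(** The element t is the product of a primitive element and a positive integer;
    its minimal polynomial over Q has integer coefficients. *)
Lemma exists_integral_primitive_element (K : fieldExtType rat) :
  exists (t : K) (p : {poly int}),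
    [/\ <<1; t>>%VS = {:K}%VS, p \is monic, size p = (\dim {:K}).+1,
        root (map_poly intr p) t &
        minPoly 1 t = map_poly intr p].
Proof.
have sepK (x : K) : separable_element 1 x.
  by apply: (@pcharf0_separable _ _ 1%AS) => i; rewrite pchar_lalg pchar_num.
have defK : {:K}%VS = <<1; separable_generator 1%AS {:K}%AS>>%VS.
  apply: eq_adjoin_separable_generator; last exact: sub1v.
  by apply/separableP=> y _; exact: sepK.
set t0 := separable_generator _ _ in defK.
have [q Dq] := polyOver1P (minPolyOver 1%AS t0).
have mq : q \is monic by rewrite -(map_monic (in_alg K)) -Dq monic_minPoly.
have [D [p [D0 mp sp pP]]] := exists_int_scaled_poly mq.
have D0K : D%:R != 0 :> K.
  by rewrite -(rmorph_nat (in_alg K)) fmorph_eq0 pnatr_eq0 -lt0n.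
pose t := t0 *+ D.
have rt : root (map_poly intr p) t by apply: pP; rewrite -Dq root_minPoly.
have gt : <<1; t>>%VS = {:K}%VS.
  apply/eqP; rewrite eqEsubv subvf defK.
  apply/FadjoinP; split; first exact: sub1v.
  have -> : t0 = D%:R^-1 * t by rewrite /t -[t0 *+ D]mulr_natl mulKf.
  apply: rpredM; last exact: memv_adjoin.
  by rewrite rpredV rpred_nat.
have degt : adjoin_degree 1 t = \dim {:K}.
  by have := dim_Fadjoin 1%AS t; rewrite gt dimv1 muln1.
have degt0 : adjoin_degree 1 t0 = \dim {:K}.
  by have := dim_Fadjoin 1%AS t0; rewrite -defK dimv1 muln1.
have spn : size p = (\dim {:K}).+1.
  by rewrite sp -(size_map_poly (in_alg K)) -Dq size_minPoly degt0.
exists t, p; split => //.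
apply/eqP; rewrite -eqp_monic ?monic_minPoly //.
  rewrite -dvdp_size_eqp.
    rewrite size_minPoly degt size_map_poly_id0 ?spn //.
    by rewrite (monicP mp) rmorph1 oner_neq0.
  apply: minPoly_dvdp => //.
  by apply/polyOverP => i; rewrite coef_map rpred_int.
by rewrite monic_map.
Qed.

(** * The order Z[t] and its norm *)

Section Order.
Variables (p : {poly int}) (n : nat).
Hypotheses (mp : p \is monic) (sp : size p = n.+1).

(** An integer row vector v stands for the polynomial of degree less than n with
    coefficients v, and [ev x v] is its value at x.  For x = t this parametrizes
    the order Z[t]; for the complex roots x of p it gives the conjugates. *)
Definition ev (R : comNzRingType) (x : R) (v : 'rV[int]_n) : R :=
  (map_poly intr (rVpoly v)).[x].

(** The matrix of the multiplication by v on Z[X] / (p), in the basis of the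
    powers of X. *)
Definition mulmat (v : 'rV[int]_n) : 'M[int]_n :=
  \matrix_(i, j) (Pdiv.Ring.rmodp ('X^i * rVpoly v) p)`_j.

(** The norm of v from Z[X] / (p) to Z. *)
Definition normz v := \det (mulmat v).

Definition powers (R : comNzRingType) (x : R) : 'cV[R]_n := \col_j x ^+ j.

Lemma ev_sum (R : comNzRingType) (x : R) v :
  ev x v = \sum_j (v 0 j)%:~R * x ^+ j.
Proof.
rewrite /ev (@horner_coef_wide _ n); last first.
  by apply: leq_trans (size_poly _ _) _; exact: size_poly.
by apply: eq_bigr => j _; rewrite coef_map coef_rVpoly_ord.
Qed.

Lemma ev_mul (R : comNzRingType) (x : R) v :
  (ev x v)%:M = map_mx intr v *m powers x.
Proof.
apply/rowP=> j; rewrite !mxE ord1 eqxx ev_sum.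
by apply: eq_bigr => i _; rewrite !mxE.
Qed.

Lemma evB (R : comNzRingType) (x : R) v w : ev x (v - w) = ev x v - ev x w.
Proof.
by rewrite !ev_sum -sumrB; apply: eq_bigr => i _; rewrite !mxE rmorphB mulrBl.
Qed.

Lemma evZ (R : comNzRingType) (x : R) a v : ev x (a *: v) = a%:~R * ev x v.
Proof. by rewrite !ev_sum mulr_sumr; apply: eq_bigr => i _; rewrite !mxE rmorphM mulrA. Qed.

(** Evaluation at a root x of p is a ring morphism on Z[X] / (p), so that the
    vector of the powers of x is an eigenvector of every [mulmat v]. *)
Lemma mulmat_powers (R : comNzRingType) (x : R) v : root (map_poly intr p) x ->
  map_mx intr (mulmat v) *m powers x = ev x v *: powers x.
Proof.
move=> /rootP px0; apply/colP=> i; rewrite !mxE.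
transitivity (map_poly intr (Pdiv.Ring.rmodp ('X^i * rVpoly v) p)).[x].
  rewrite (@horner_coef_wide _ n); last first.
    apply: leq_trans (size_poly _ _) _.
    by rewrite -ltnS -sp Pdiv.Ring.ltn_rmodp monic_neq0.
  by apply: eq_bigr => j _; rewrite !mxE coef_map.
have /(congr1 (fun f => (map_poly intr f).[x])) :=
  Pdiv.RingMonic.rdivp_eq mp ('X^i * rVpoly v).
rewrite rmorphD !rmorphM /= hornerD !hornerM px0 mulr0 add0r => <-.
by rewrite map_polyXn hornerXn mulrC.
Qed.

(** An element divides its norm in Z[t]: the cofactor g is the first row of the
    adjugate matrix of [mulmat v]. *)
Lemma ev_dvd_norm v : (0 < n)%N -> exists g, forall (R : comNzRingType) (x : R),
  root (map_poly intr p) x -> ev x v * ev x g = (normz v)%:~R.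
Proof.
move=> n0; pose i0 := Ordinal n0.
exists (row i0 (\adj (mulmat v))) => R x rx.
have := congr1 (map_mx (intr : int -> R)) (mul_adj_mx (mulmat v)).
rewrite map_mxM => /(congr1 (fun A => (A *m powers x) i0 0)).
rewrite -mulmxA mulmat_powers // -scalemxAr map_scalar_mx mul_scalar_mx !mxE mulr1 => <-.
by congr (_ * _); rewrite ev_sum; apply: eq_bigr => i _; rewrite !mxE.
Qed.

Lemma size_roots (F : fieldType) (rs : seq F) :
  map_poly intr p = \prod_(r <- rs) ('X - r%:P) -> size rs = n.
Proof.
move=> Dp; apply: succn_inj; rewrite -(size_prod_XsubC rs id) -Dp -sp.
by rewrite size_map_poly_id0 // (monicP mp) rmorph1 oner_neq0.
Qed.

(** The norm is the product of the conjugates: the Vandermonde matrix of the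
    roots, invertible as they are distinct, diagonalizes [mulmat v]. *)
Lemma norm_prod (F : fieldType) (rs : seq F) v : uniq rs ->
  map_poly intr p = \prod_(r <- rs) ('X - r%:P) ->
  (normz v)%:~R = \prod_(r <- rs) ev r v.
Proof.
move=> urs Dp; have srs := size_roots Dp.
pose a : 'rV[F]_n := \row_j rs`_j.
pose V := Vandermonde n a.
have ra j : root (map_poly intr p) (a 0 j).
  by rewrite Dp root_prod_XsubC !mxE mem_nth // srs.
have detV : \det V != 0.
  rewrite det_Vandermonde; apply/prodf_neq0 => i _; apply/prodf_neq0 => j ltij.
  by rewrite !mxE subr_eq0 nth_uniq ?srs // gtn_eqF.
have eqV : map_mx intr (mulmat v) *m V = V *m diag_mx (\row_j ev (a 0 j) v).
  apply/matrixP=> i j.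
  have := congr1 (fun A : 'cV_n => A i 0) (mulmat_powers v (ra j)).
  rewrite /V mul_mx_diag !mxE mulrC => <-.
  by apply: eq_bigr => k _; rewrite !mxE.
have := congr1 determinant eqV.
rewrite !det_mulmx det_map_mx mulrC => /(mulfI detV) ->.
rewrite det_diag (big_nth 0) srs big_mkord.
by apply: eq_bigr => i _; rewrite !mxE.
Qed.

(** A row w with w M = 0, for M the matrix of v, would give (w . powers) v(t) = 0,
    whereas the powers of t are linearly independent over Q. *)
Lemma norm_neq0 (F : fieldExtType rat) (t : F) v :
  (forall q : {poly rat}, (size q <= n)%N -> root (map_poly (in_alg F) q) t -> q = 0) ->
  root (map_poly intr p) t -> v != 0 -> normz v != 0.
Proof.
move=> fr rt; apply: contra => norm0.
have : \det (map_mx (intr : int -> rat) (mulmat v)) == 0.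
  by rewrite det_map_mx intr_eq0.
case/det0P=> w w0 wM.
have evw (u : 'rV[rat]_n) :
    (map_poly (in_alg F) (rVpoly u)).[t] = (map_mx (in_alg F) u *m powers t) 0 0.
  rewrite (@horner_coef_wide _ n); last first.
    by apply: leq_trans (size_poly _ _) _; exact: size_poly.
  by rewrite mxE; apply: eq_bigr => j _; rewrite coef_map coef_rVpoly_ord !mxE.
have rVinj (u : 'rV[rat]_n) : root (map_poly (in_alg F) (rVpoly u)) t -> u = 0.
  move=> ru; rewrite -[u]rVpolyK (fr (rVpoly u)) ?linear0 //.
  exact: size_poly.
have evv : ev t v = 0.
  have := congr1 (map_mx (in_alg F)) wM.
  rewrite map_mxM -map_mx_comp /= (eq_map_mx _ (_ : _ =1 intr)); last first.
    by move=> z /=; rewrite -(rmorph_int (in_alg F)).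
  move=> /(congr1 (fun A => (A *m powers t) 0 0)).
  rewrite -mulmxA mulmat_powers // -scalemxAr map_mx0 mul0mx [LHS]mxE -evw mxE.
  move/eqP; rewrite mulf_eq0 => /orP[/eqP//|].
  by move=> /rVinj w00; rewrite w00 eqxx in w0.
apply/eqP/rowP => j.
have /rVinj : root (map_poly (in_alg F) (rVpoly (map_mx (intr : int -> rat) v))) t.
  rewrite /root evw -map_mx_comp (eq_map_mx _ (_ : _ =1 intr)); last first.
    by move=> z /=; rewrite -(rmorph_int (in_alg F)).
  by rewrite -ev_mul mxE evv mul0rn.
move=> /rowP /(_ j); rewrite !mxE => /eqP.
by rewrite intr_eq0 => /eqP.
Qed.
End Order.

(** * Colouring a disk at an archimedean place *)

(** The interval of radius R is cut into N subintervals, and f w is the index of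
    the one that contains w. *)
Lemma real_color_exists (R : algC) (N : nat) : 0 < R -> (0 < N)%N ->
  exists f : algC -> nat,
    (forall w, w \is Num.real -> `|w| < R -> (f w < N)%N) /\
    (forall w w', w \is Num.real -> w' \is Num.real -> `|w| < R -> `|w'| < R ->
       f w = f w' -> `|w - w'| <= 2 * R / N%:R).
Proof.
move=> R0 N0; have N0' : 0 < N%:R :> algC by rewrite ltr0n.
pose s := N%:R / (2 * R); have s0 : 0 < s by rewrite divr_gt0 ?mulr_gt0.
have pos w : w \is Num.real -> `|w| < R -> 0 <= (w + R) * s.
  move=> rw; rewrite real_ltr_norml // => /andP[lw _].
  by rewrite mulr_ge0 ?ltW // -ltrBlDr sub0r.
exists (fun w => Num.truncn ((w + R) * s)); split=> [w rw wR | w w' rw rw' wR w'R eqf].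
  rewrite truncn_lt_nat ?pos //.
  move: wR; rewrite real_ltr_norml // => /andP[_ lw].
  rewrite /s mulrA ltr_pdivrMr ?mulr_gt0 // mulrC ltr_pM2l //.
  by rewrite mulr2n mulrDl mul1r ltrD2r.
have /andP[] := truncn_itv (pos _ rw wR); have /andP[] := truncn_itv (pos _ rw' w'R).
rewrite eqf; set k := Num.truncn _ => k1 k2 k3 k4.
suff : `|w - w'| * s <= 1.
  by rewrite -ler_pdivlMr // /s invfM invrK mul1r mulrC.
rewrite -(gtr0_norm s0) -normrM mulrBl.
have -> : w * s - w' * s = (w + R) * s - (w' + R) * s.
  by rewrite !mulrDl opprD addrACA subrr addr0.
have rR : R \is Num.real by rewrite gtr0_real.
have rs : s \is Num.real by rewrite gtr0_real.
rewrite real_ler_norml; last by apply: realB; apply: realM => //; apply: realD.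
rewrite lerNl opprB; apply/andP; split.
  by rewrite lerBlDr; apply: le_trans (ltW k2) _; rewrite -natr1 addrC lerD2l.
by rewrite lerBlDr; apply: le_trans (ltW k4) _; rewrite -natr1 addrC lerD2l.
Qed.

(** The local degree of the archimedean place given by the embedding that sends
    the generator t to z. *)
Definition place_degree (z : algC) : nat := if z \is Num.real then 1 else 2.

(** With q^2 colours, points of the same colour are at a distance that is
    O(R / q^2) on the real line and O(R / q) in the plane.  Raised to the local
    degree, both bounds are of the order of R^e / q^2. *)
Lemma disk_color_exists (z : algC) (R : algC) (q : nat) : 0 < R -> (0 < q)%N ->
  exists f : algC -> nat, let ok w := `|w| < R /\ (z \is Num.real -> w \is Num.real) in
    (forall w, ok w -> (f w < q ^ 2)%N) /\
    (forall w w', ok w -> ok w' -> f w = f w' ->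
       `|w - w'| ^+ place_degree z <= 8 * R ^+ place_degree z / (q ^ 2)%:R).
Proof.
move=> R0 q0; rewrite /place_degree; case: ifP => rz.
  have [|f [f1 f2]] := @real_color_exists R (q ^ 2) R0; first by rewrite expn_gt0 q0.
  exists f; split=> [w [wR rw]|w w' [wR rw] [w'R rw'] eqf]; first by apply: f1; rewrite ?rw.
  rewrite !expr1; apply: le_trans (f2 _ _ _ _ _ _ eqf) _; rewrite ?rw ?rw' //.
  by rewrite !ler_pM2r ?invr_gt0 ?ltr0n ?expn_gt0 ?q0 // ler_nat.
(* At a complex place, the colour encodes a pair of colours, one for the real
   part and one for the imaginary part. *)
have [f [f1 f2]] := real_color_exists R0 q0.
have bRe w : `|w| < R -> `|'Re w| < R by apply: le_lt_trans; rewrite leif_normC_Re_Creal.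
have bIm w : `|w| < R -> `|'Im w| < R.
  apply: le_lt_trans; rewrite -ler_sqr ?nnegrE // (normC2_Re_Im w).
  by rewrite real_normK ?Creal_Im // lerDr real_exprn_even_ge0 ?Creal_Re.
exists (fun w => f ('Re w) * q + f ('Im w))%N; split=> [w [wR _]|w w' [wR _] [w'R _]].
  have a1 := f1 _ (Creal_Re w) (bRe _ wR).
  have a2 := f1 _ (Creal_Im w) (bIm _ wR).
  rewrite expnS expn1; apply: (@leq_trans ((f ('Re w)).+1 * q)); last first.
    by rewrite leq_mul2r a1 orbT.
  by rewrite mulSn addnC ltn_add2r.
have a1 := f1 _ (Creal_Im w) (bIm _ wR).
have a2 := f1 _ (Creal_Im w') (bIm _ w'R).
move=> eqf.
have /f2 h1 : f ('Re w) = f ('Re w').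
  have /(congr1 (fun m => m %/ q)%N) := eqf.
  by rewrite !divnMDl // !divn_small // !addn0.
have /f2 h2 : f ('Im w) = f ('Im w').
  have /(congr1 (fun m => m %% q)%N) := eqf.
  by rewrite !modnMDl !modn_small.
rewrite normC2_Re_Im !raddfB /=.
have q0' : 0 < q%:R :> algC by rewrite ltr0n.
have B0 : 0 <= 2 * R / q%:R by rewrite divr_ge0 ?mulr_ge0 ?ltW.
have -> : 8 * R ^+ 2 / (q ^ 2)%:R = (2 * R / q%:R) ^+ 2 + (2 * R / q%:R) ^+ 2.
  by rewrite natrX -exprVn; move: (q%:R^-1) => i; ring.
have sq x : x \is Num.real -> `|x| <= 2 * R / q%:R -> x ^+ 2 <= (2 * R / q%:R) ^+ 2.
  by move=> rx xB; rewrite -(real_normK rx) lerXn2r ?nnegrE.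
apply: lerD; apply: sq.
- by apply: realB; apply: Creal_Re.
- by apply: h1; rewrite ?Creal_Re ?bRe.
- by apply: realB; apply: Creal_Im.
- by apply: h2; rewrite ?Creal_Im ?bIm.
Qed.

(** * Small elements of bounded norm *)

Lemma dist_nat_le (a b c : nat) : (a < c)%N -> (b < c)%N -> `|a%:Z - b%:Z| <= c%:Z.
Proof. by move=> ac bc; rewrite ler_norml; lia. Qed.

Lemma horner_int_poly_conjC (f : {poly int}) (z : algC) :
  (map_poly intr f).[z^*] = ((map_poly intr f).[z])^*.
Proof.
rewrite -horner_map -map_poly_comp; congr (_.[_]).
by apply: eq_map_poly => i /=; rewrite rmorph_int.
Qed.

Section SmallElements.
Variables (p : {poly int}) (n : nat) (rs : seq algC).
Hypotheses (mp : p \is monic) (sp : size p = n.+1).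
Hypotheses (urs : uniq rs) (Dp : map_poly intr p = \prod_(r <- rs) ('X - r%:P)).

(** A constant c such that, for h > 0, a vector with entries at most h in absolute
    value has all its conjugates smaller than c h. *)
Definition house_const : algC := 1 + \sum_(r <- rs) \sum_(j < n) `|r| ^+ j.

Lemma house_const_gt0 : 0 < house_const.
Proof.
rewrite ltr_pwDl // sumr_ge0 // => r _; rewrite sumr_ge0 // => j _.
by rewrite exprn_ge0.
Qed.

Lemma normr_ev_lt (h : nat) (v : 'rV[int]_n) (r : algC) : (0 < h)%N -> r \in rs ->
  (forall j, `|v 0 j| <= h%:Z) -> `|ev r v| < house_const * h%:R.
Proof.
move=> h0 rin vh; rewrite ev_sum.
apply: le_lt_trans (ler_norm_sum _ _ _) _.
apply: (@le_lt_trans _ _ (h%:R * \sum_(j < n) `|r| ^+ j)).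
  rewrite mulr_sumr; apply: ler_sum => j _.
  rewrite normrM normrX ler_wpM2r ?exprn_ge0 //.
  by rewrite -intr_norm -[h%:R]/(h%:Z%:~R) ler_int.
rewrite mulrC ltr_pM2r ?ltr0n // /house_const (big_rem r) //=.
rewrite ltr_pwDl // lerDl sumr_ge0 // => s _; rewrite sumr_ge0 // => j _.
by rewrite exprn_ge0.
Qed.

Lemma ev_real (r : algC) (v : 'rV[int]_n) : r \is Num.real -> ev r v \is Num.real.
Proof.
move=> rr; rewrite ev_sum; apply: rpred_sum => j _.
by rewrite rpredM ?rpredX // Rreal_int // ?intr_int.
Qed.

(** Pigeonhole principle: the box of vectors with entries in [0, h^2) has
    h^(2n) > q^2 elements for q = h^n - 1, so two of them have conjugates at z
    of the same colour. *)
Lemma short_vector_exists (z : algC) (h : nat) : z \in rs -> (1 < h)%N -> (0 < n)%N ->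
  exists v : 'rV[int]_n, let R := house_const * (h ^ 2)%:R in
    [/\ v != 0, forall r, r \in rs -> `|ev r v| < R &
      `|ev z v| ^+ place_degree z <=
        8 * R ^+ place_degree z / ((h ^ n).-1 ^ 2)%:R].
Proof.
move=> zin h1 n0; set R := house_const * _.
have h0 : (0 < h)%N by exact: ltnW.
have hn1 : (1 < h ^ n)%N by rewrite -(exp1n n) ltn_exp2r.
have R0 : 0 < R by rewrite mulr_gt0 ?house_const_gt0 // ltr0n expn_gt0 h0.
have q0 : (0 < (h ^ n).-1)%N by rewrite -ltnS prednK // ltnW.
have [f [f1 f2]] := disk_color_exists z R0 q0.
set q := (h ^ n).-1 in q0 f f1 f2 *.
pose vec (x : {ffun 'I_n -> 'I_(h ^ 2)}) : 'rV[int]_n := \row_j (x j : nat)%:Z.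
have ok x : `|ev z (vec x)| < R /\ (z \is Num.real -> ev z (vec x) \is Num.real).
  split; last exact: ev_real.
  apply: normr_ev_lt; rewrite ?expn_gt0 ?h0 // => j.
  by rewrite mxE lez_nat ltnW // ltn_ord.
pose g x : 'I_(q ^ 2) := Ordinal (f1 _ (ok x)).
have : ~~ injectiveb g.
  apply/negP => /injectiveP /leq_card; rewrite card_ffun !card_ord leqNgt.
  rewrite -expnM mulnC expnM ltn_sqr => /negP; apply.
  by rewrite /q prednK // ltnW.
case/injectivePn => x [y xy gxy]; exists (vec x - vec y).
split.
- rewrite subr_eq0; apply: contra xy => /eqP/rowP e.
  apply/eqP/ffunP => j; apply: val_inj.
  by have := e j; rewrite !mxE => -[].
- move=> r rin; apply: normr_ev_lt; rewrite ?expn_gt0 ?h0 // => j.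
  by rewrite !mxE; apply: dist_nat_le.
rewrite evB; apply: f2 => //.
by have := congr1 val gxy.
Qed.

(** The place of z accounts for e factors of the norm: at a complex place, the
    conjugate of z is another root of p. *)
Lemma norm_le (z : algC) (v : 'rV[int]_n) (R : algC) :
  z \in rs -> 0 <= R -> (forall r, r \in rs -> `|ev r v| <= R) ->
  exists k, (k + place_degree z = n)%N /\
  `|(normz p v)%:~R| <= `|ev z v| ^+ place_degree z * R ^+ k.
Proof.
move=> zin R0 vR.
have srs : size rs = n := size_roots mp sp Dp.
have prodR s : {subset s <= rs} -> \prod_(r <- s) `|ev r v| <= R ^+ size s.
  elim: s => [|r s IH] sub; first by rewrite big_nil.
  rewrite big_cons exprS; apply: ler_pM => //.
  - by apply: prodr_ge0.
  - by apply: vR; apply: sub; rewrite mem_head.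
  - by apply: IH => u us; apply: sub; rewrite in_cons us orbT.
rewrite (norm_prod mp sp v urs Dp) normr_prod (perm_big _ (perm_to_rem zin)) big_cons /=.
rewrite /place_degree; case: ifPn => rz.
  exists n.-1; split; first by rewrite -srs addn1 prednK //; case: (rs) zin.
  have szr : size (rem z rs) = n.-1 by rewrite size_rem // srs.
  by rewrite expr1 ler_wpM2l // -szr prodR // => u; exact: mem_rem.
have zcin : z^* \in rem z rs.
  rewrite mem_rem_uniq // inE /=; apply/andP; split.
    by apply: contra rz => /eqP e; rewrite CrealE e.
  rewrite -root_prod_XsubC -Dp /root horner_int_poly_conjC fmorph_eq0.
  by rewrite -/(root _ z) Dp root_prod_XsubC.
have szz : size (rem z^* (rem z rs)) = n.-2 by rewrite !size_rem // srs.
exists n.-2; split.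
  have : (0 < size (rem z rs))%N by case: (rem z rs) zcin.
  by rewrite size_rem // srs addn2; case: (n) => [|[|m]].
rewrite (perm_big _ (perm_to_rem zcin)) big_cons /= /ev horner_int_poly_conjC norm_conjC.
rewrite mulrA -expr2 ler_wpM2l ?exprn_ge0 // -szz prodR // => u.
by move/mem_rem/mem_rem.
Qed.

(** For the difference v of [short_vector_exists], with R = c h^2,
    |v(z)|^e h^(2n) <= 32 R^e.  As e < n, the conjugate at z tends to 0 when h
    grows; and the norm is at most 32 R^n / h^(2n) = 32 c^n. *)
Lemma small_elements_bounded_norm (z : algC) : z \in rs -> (place_degree z < n)%N ->
  exists C : nat, forall e : algC, 0 < e ->
    exists v : 'rV[int]_n, [/\ v != 0, `|ev z v| ^+ place_degree z < e &
      (`|normz p v| <= C)%N].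
Proof.
move=> zin dn; set d := place_degree z in dn *; set c := house_const.
have c0 : 0 < c := house_const_gt0.
have n0 : (0 < n)%N by apply: leq_trans dn.
pose B := 32 * c ^+ n; have B0 : 0 <= B by rewrite mulr_ge0 ?exprn_ge0 ?ltW.
exists (Num.truncn B) => e e0.
have eB0 : 0 <= 32 * c ^+ d / e by rewrite divr_ge0 ?mulr_ge0 ?exprn_ge0 ?ltW.
pose h := (Num.truncn (32 * c ^+ d / e)).+2.
have hB : 32 * c ^+ d / e < h%:R.
  apply: lt_trans (_ : (Num.truncn (32 * c ^+ d / e)).+1%:R < _); last by rewrite ltr_nat.
  by have /andP[] := truncn_itv eB0.
have h1 : (1 < h)%N by [].
have [v [v0 vR vz]] := short_vector_exists zin h1 n0.
exists v; move: vz; rewrite -/d -/c; set R := c * _ in vR * => vz.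
have R0 : 0 < R by rewrite mulr_gt0 // ltr0n.
have h0 : 0 < h%:R :> algC by rewrite ltr0n.
(* It suffices that 2 (h^n - 1) >= h^n. *)
have hn1 : (1 < h ^ n)%N by rewrite -(exp1n n) ltn_exp2r.
have q0 : (0 < (h ^ n).-1)%N by rewrite -ltnS prednK // ltnW.
have hq : (h ^ (2 * n) <= 4 * (h ^ n).-1 ^ 2)%N.
  rewrite mulnC expnM -[X in (X * _)%N]/(2 ^ 2)%N -expnMn leq_sqr.
  by case: (h ^ n)%N hn1 => [|[|m]] //= _;
    rewrite mulnS mulSn addnA -[m.+2]addn2 addnC leq_addr.
have vz' : `|ev z v| ^+ d * h%:R ^+ (2 * n) <= 32 * R ^+ d.
  have X0 : 0 <= `|ev z v| ^+ d by rewrite exprn_ge0.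
  apply: (@le_trans _ _ (`|ev z v| ^+ d * (4 * (h ^ n).-1 ^ 2)%:R)).
    by rewrite -natrX ler_wpM2l // ler_nat.
  move: vz; rewrite ler_pdivlMr ?ltr0n ?expn_gt0 ?q0 // => vz.
  have -> : 32 = 4 * 8 :> algC by rewrite -natrM.
  rewrite natrM mulrCA -[4 * 8 * _]mulrA.
  by rewrite ler_wpM2l // ler0n.
split=> //.
  rewrite -(ltr_pM2r (_ : 0 < h%:R ^+ (2 * n))) ?exprn_gt0 //.
  apply: le_lt_trans vz' _.
  rewrite /R exprMn natrX -exprM mulrA.
  apply: (@lt_le_trans _ _ (e * h%:R * h%:R ^+ (2 * d))).
    by rewrite ltr_pM2r ?exprn_gt0 // [ltRHS]mulrC -ltr_pdivrMr.
  rewrite -mulrA -exprS ler_wpM2l ?(ltW e0) // ler_eXn2l ?ltr1n //.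
  by rewrite ltn_pmul2l.
have [k [kd nk]] := norm_le zin (ltW R0) (fun r rin => ltW (vR r rin)).
rewrite truncn_ge_nat //.
have -> : (`|normz p v|%N)%:R = `|(normz p v)%:~R| :> algC.
  by rewrite -intr_norm -abszE.
rewrite -(ler_pM2r (_ : 0 < h%:R ^+ (2 * n))) ?exprn_gt0 //.
apply: le_trans (_ : `|ev z v| ^+ d * R ^+ k * h%:R ^+ (2 * n) <= _).
  by rewrite ler_wpM2r // exprn_ge0 // ltW.
rewrite mulrAC; apply: le_trans (_ : 32 * R ^+ d * R ^+ k <= _).
  by rewrite ler_wpM2r // exprn_ge0 // ltW.
by rewrite -mulrA -exprD addnC kd /R exprMn natrX -exprM /B mulrA.
Qed.
End SmallElements.

(** * Units congruent to 1 *)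

Lemma algebraic_integerD (K : fieldExtType rat) (x y : K) :
  algebraic_integer x -> algebraic_integer y -> algebraic_integer (x + y).
Proof. exact: integral_add. Qed.

Lemma algebraic_integerB (K : fieldExtType rat) (x y : K) :
  algebraic_integer x -> algebraic_integer y -> algebraic_integer (x - y).
Proof. exact: integral_sub. Qed.

Lemma algebraic_integerM (K : fieldExtType rat) (x y : K) :
  algebraic_integer x -> algebraic_integer y -> algebraic_integer (x * y).
Proof. exact: integral_mul. Qed.

Lemma algebraic_integer_int (K : fieldExtType rat) (m : int) :
  algebraic_integer (m%:~R : K).
Proof. exact: integral_id. Qed.

Lemma algebraic_integerX (K : fieldExtType rat) (x : K) k :
  algebraic_integer x -> algebraic_integer (x ^+ k).
Proof.
move=> hx; elim: k => [|k IH]; first exact: (algebraic_integer_int K 1).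
by rewrite exprS; exact: algebraic_integerM.
Qed.

Lemma algebraic_integer_ev (K : fieldExtType rat) (t : K) n (v : 'rV[int]_n) :
  algebraic_integer t -> algebraic_integer (ev t v).
Proof.
move=> ht; rewrite ev_sum; elim/big_ind: _ => [||j _].
- exact: (algebraic_integer_int K 0).
- exact: algebraic_integerD.
by apply: algebraic_integerM (algebraic_integer_int _ _) (algebraic_integerX _ ht).
Qed.

(** The order of algC is partial; the inverse of 1 + sum of the inverses replaces
    the minimum. *)
Lemma positive_lower_bound (T : eqType) (F : T -> algC) (s : seq T) :
  (forall v, v \in s -> 0 < F v) -> exists2 e, 0 < e & forall v, v \in s -> e <= F v.
Proof.
move=> F0; have S0 : 0 < 1 + \sum_(v <- s) (F v)^-1.
  by rewrite ltr_pwDl // big_seq sumr_ge0 // => v /F0 vs; rewrite invr_ge0 ltW.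
exists (1 + \sum_(v <- s) (F v)^-1)^-1; first by rewrite invr_gt0.
move=> v vs; rewrite -[leRHS]invrK lef_pV2 ?posrE ?invr_gt0 ?F0 //.
rewrite (big_rem v) //= addrCA lerDl addr_ge0 // big_seq sumr_ge0 // => w ws.
by rewrite invr_ge0 ltW // F0 //; apply: mem_rem ws.
Qed.

(** Congruence modulo L of integer vectors has finitely many classes. *)
Lemma congruent_rows (n L : nat) : (0 < L)%N ->
  exists (I : finType) (k : 'rV[int]_n -> I), forall v w, k v = k w ->
    exists u, v - w = L%:Z *: u.
Proof.
(* Remainders modulo L; the bound L.+1 makes [inord] available. *)
move=> L0; exists {ffun 'I_n -> 'I_L.+1}.
exists (fun v : 'rV[int]_n => [ffun j : 'I_n => inord `|(v ord0 j %% L%:Z)%Z|%N]).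
move=> v w /ffunP e; exists (\row_j ((v ord0 j - w ord0 j) %/ L%:Z)%Z).
apply/rowP => j; rewrite !mxE mulrC divzK //.
rewrite -eqz_mod_dvd; have := e j; rewrite !ffunE => /(congr1 val).
have LZ : L%:Z != 0 by rewrite eqz_nat -lt0n.
have lt (x : int) : (`|(x %% L%:Z)%Z| < L.+1)%N.
  by rewrite ltnS -lez_nat gez0_abs ?modz_ge0 // ltW // ltz_pmod.
rewrite /= !inordK // => /(congr1 Posz); rewrite !gez0_abs ?modz_ge0 //.
by move=> ->.
Qed.

(** The units of the ring of integers of K that are congruent to 1 modulo M. *)
Definition units_congr1 (K : fieldExtType rat) (M : nat) : set K :=
  [set u | [/\ u != 0, algebraic_integer u, algebraic_integer u^-1 &
     exists2 w, algebraic_integer w & u - 1 = M%:R * w]].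

Section InfiniteUnits.
Variables (K : fieldExtType rat) (t : K) (p : {poly int}) (n : nat) (rs : seq algC).
Hypotheses (mp : p \is monic) (sp : size p = n.+1) (rt : root (map_poly intr p) t).
Hypothesis (fr : forall q : {poly rat}, (size q <= n)%N ->
  root (map_poly (in_alg K) q) t -> q = 0).
Hypotheses (urs : uniq rs) (Dp : map_poly intr p = \prod_(r <- rs) ('X - r%:P)).

Lemma integral_generator : algebraic_integer t.
Proof. by exists p. Qed.

Lemma ev_neq0 (v : 'rV[int]_n) : v != 0 -> ev t v != 0.
Proof.
move=> v0; have n0 : (0 < n)%N.
  by case: (posnP n) v v0 => // -> v; rewrite thinmx0 eqxx.
have [g /(_ K t rt) vg] := ev_dvd_norm mp sp v n0.
have Nv : normz p v != 0 by exact: (norm_neq0 mp sp fr rt).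
apply: contraNneq Nv => e; rewrite e mul0r in vg.
by rewrite -(intr_eq0 rat) -(fmorph_eq0 (in_alg K)) rmorph_int -vg.
Qed.

(** If v and w are congruent modulo C! M, then v / w - 1 = (C! M / w) u(t) for
    some u, and w divides its norm, which divides C!.  By symmetry w / v is
    integral as well. *)
Lemma ratio_in_units_congr1 (C M : nat) (v w u : 'rV[int]_n) : (0 < n)%N ->
  v != 0 -> w != 0 -> (`|normz p v| <= C)%N -> (`|normz p w| <= C)%N ->
  v - w = (C`! * M)%N%:Z *: u -> units_congr1 M (ev t v / ev t w).
Proof.
move=> n0.
have key (x y s : 'rV[int]_n) : y != 0 -> (`|normz p y| <= C)%N ->
   x - y = (C`! * M)%N%:Z *: s ->
   ev t y != 0 /\ exists2 a, algebraic_integer a & ev t x / ev t y - 1 = M%:R * a.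
  move=> y0 yC xy; have [g /(_ K t rt) yg] := ev_dvd_norm mp sp y n0.
  have Ny : normz p y != 0 by exact: (norm_neq0 mp sp fr rt).
  have ey : ev t y != 0 by exact: ev_neq0.
  split=> //.
  have /dvdnP[k Dk] : (`|normz p y| %| C`!)%N by rewrite dvdn_fact // yC absz_gt0 Ny.
  have [k' Dk'] : exists k' : int, (C`!)%:Z = k' * normz p y.
    exists (k%:Z * sgz (normz p y)); rewrite Dk PoszM.
    by rewrite -mulrA -abszEsg.
  exists (k'%:~R * ev t g * ev t s).
    apply: algebraic_integerM (algebraic_integer_ev _ integral_generator).
    apply: algebraic_integerM (algebraic_integer_int _ _) _.
    exact: algebraic_integer_ev integral_generator.
  have -> : ev t x = ev t y + (C`! * M)%N%:Z%:~R * ev t s.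
    by rewrite -evZ -xy evB addrC subrK.
  rewrite mulrDl divff // addrAC subrr add0r PoszM Dk' !rmorphM /= -yg.
  rewrite -[M%:Z%:~R]/(M%:R).
  by move: (ev t y) (ev t g) (ev t s) (k'%:~R) (M%:R) ey => a b c d e a0; field.
move=> v0 w0 vC wC vw.
have [ew [a ha Ea]] := key v w u w0 wC vw.
have [|ev' [b hb Eb]] := key w v (-u) v0 vC.
  by rewrite scalerN -vw opprB.
have hM : algebraic_integer (M%:R : K) by exact: (algebraic_integer_int K M%:Z).
have h1 : algebraic_integer (1 : K) by exact: (algebraic_integer_int K 1).
split.
- by rewrite mulf_neq0 ?invr_neq0.
- rewrite -[_ / _](subrK 1) Ea; apply: algebraic_integerD h1.
  exact: algebraic_integerM.
- rewrite invf_div -[_ / _](subrK 1) Eb; apply: algebraic_integerD h1.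
  exact: algebraic_integerM.
by exists a.
Qed.

Lemma ev_conj_neq0 (z : algC) (v : 'rV[int]_n) : z \in rs -> v != 0 -> ev z v != 0.
Proof.
move=> zin v0.
have Nv : normz p v != 0 by exact: (norm_neq0 mp sp fr rt).
have : (normz p v)%:~R != 0 :> algC by rewrite intr_eq0.
by rewrite (norm_prod mp sp v urs Dp) (big_rem z) //= mulf_eq0 negb_or => /andP[].
Qed.

(** If there were finitely many such units, there would be finitely many elements
    of norm at most C, as each class modulo C! M is contained in a multiple of
    the set of these units; but these elements take arbitrarily small nonzero values at z. *)
Lemma infinite_units_congr1_of_place (M : nat) z : (0 < M)%N -> z \in rs ->
  (place_degree z < n)%N -> infinite_set (@units_congr1 K M).
Proof.
move=> M0 zin dn Ufin.
have n0 : (0 < n)%N by apply: leq_trans dn.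
have [C HC] := small_elements_bounded_norm mp sp urs Dp zin dn.
have [|I [k kP]] := @congruent_rows n (C`! * M)%N; first by rewrite muln_gt0 fact_gt0.
pose X := [set v : 'rV[int]_n | v != 0 /\ (`|normz p v| <= C)%N].
have finX : finite_set X.
  apply: (@sub_finite_set _ _ (\bigcup_(c in setT) (X `&` k @^-1` [set c]))).
    by move=> v Xv; exists (k v).
  apply: bigcup_finite => [|c _]; first exact: finite_finset.
  have [->|/set0P[w [[w0 wC] kw]]] := eqVneq (X `&` k @^-1` [set c]) set0.
    exact: finite_set0.
  apply: (@sub_finite_set _ _ ((fun v => ev t v / ev t w) @^-1` @units_congr1 K M)).
    move=> v [[v0 vC] kv]; have [|u vw] := kP v w; first by rewrite kv kw.
    exact: ratio_in_units_congr1 vw.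
  apply: finite_preimage => // v v' _ _ /(divIf (ev_neq0 w0))/eqP.
  rewrite -subr_eq0 -evB; apply: contraTeq.
  by rewrite -subr_eq0 => /ev_neq0.
have /finite_seqP[s Es] := finX.
have [v vs|e e0 eP] := @positive_lower_bound _ (fun v => `|ev z v| ^+ place_degree z) s.
  have [v0 _] : X v by rewrite Es.
  by rewrite exprn_gt0 // normr_gt0 ev_conj_neq0.
have [v [v0 ve vC]] := HC e e0.
have : v \in s by have : X v by []; rewrite Es.
by move/eP => /le_lt_trans /(_ ve); rewrite ltxx.
Qed.
End InfiniteUnits.

(** * Fields with infinitely many units *)

Lemma separable_int_poly (K : fieldExtType rat) (t : K) (p : {poly int}) :
  minPoly 1 t = map_poly intr p ->
  separable_poly (map_poly intr p : {poly algC}).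
Proof.
move=> Dp.
have sepK : separable_element 1 t.
  by apply: (@pcharf0_separable _ _ 1%AS) => i; rewrite pchar_lalg pchar_num.
have e1 : map_poly (in_alg K) (map_poly intr p) = map_poly intr p.
  by rewrite -map_poly_comp; apply: eq_map_poly => i /=; rewrite -(rmorph_int (in_alg K)).
have e2 : map_poly (ratr : rat -> algC) (map_poly intr p) = map_poly intr p.
  by rewrite -map_poly_comp; apply: eq_map_poly => i /=; rewrite ratr_int.
by rewrite -e2 separable_map -(separable_map (in_alg K)) e1 -Dp.
Qed.

(** If t^2 + b t + c = 0 and D = b^2 - 4 c is negative, then K = Q(2 t + b) with
    (2 t + b)^2 = D; otherwise the minimal polynomial of t has a real root. *)
Lemma real_root_of_not_imaginary_quadratic (K : fieldExtType rat) (t : K) (p : {poly int}) :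
  <<1; t>>%VS = {:K}%VS -> p \is monic -> size p = 3%N -> root (map_poly intr p) t ->
  ~ imaginary_quadratic K ->
  exists2 z : algC, root (map_poly intr p) z & z \is Num.real.
Proof.
move=> gt mp sp rt nIQ.
have p2 : p`_2 = 1 by move/monicP: mp; rewrite lead_coefE sp.
have pE (R : comNzRingType) (x : R) :
    (map_poly intr p).[x] = (p`_0)%:~R + (p`_1)%:~R * x + x ^+ 2.
  rewrite (@horner_coef_wide _ 3); last by apply: leq_trans (size_poly _ _) _; rewrite sp.
  by rewrite !big_ord_recl big_ord0 !coef_map /= p2 addr0 expr0 mulr1 expr1 mul1r addrA.
set b := p`_1 in pE; set c := p`_0 in pE.
pose D : int := b ^+ 2 - 4 * c.
have [D0|D0] := lerP 0 D.
  exists ((sqrtC D%:~R - b%:~R) / 2).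
    have := sqrtCK (D%:~R : algC); move: (sqrtC _) => s s2.
    rewrite /root pE; apply/eqP.
    have -> : c%:~R = (b%:~R ^+ 2 - s ^+ 2) / 4 :> algC.
      by rewrite s2 /D rmorphB rmorphXn rmorphM /=; field.
    by field.
  apply: realM; last by rewrite realV realn.
  apply: realB; last by rewrite Rreal_int ?intr_int.
  by rewrite ger0_real // sqrtC_ge0 ler0z.
case: nIQ; exists `|D|%N, (2 * t + b%:~R); split.
- by rewrite absz_gt0 lt_eqF.
- have -> : - (`|D|%N)%:R = D%:~R :> K.
    by rewrite -[_%:R]/((`|D|%N)%:Z%:~R) abszE ltr0_norm // rmorphN opprK.
  have /rootP := rt; rewrite pE => /eqP; rewrite addrC addr_eq0 => /eqP e.
  by rewrite /D rmorphB rmorphXn rmorphM /= sqrrD exprMn e; ring.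
apply/eqP; rewrite eqEsubv subvf -gt; apply/FadjoinP; split; first exact: sub1v.
have tE : t = 2%:R^-1 * ((2 * t + b%:~R) - b%:~R).
  by rewrite addrK mulKf // -(rmorph_nat (in_alg K)) fmorph_eq0.
rewrite [X in X \in _]tE; apply: rpredM; first by rewrite rpredV rpred_nat.
by apply: rpredB; [exact: memv_adjoin | exact: rpred_int].
Qed.

(** A field of degree 2 that is not imaginary quadratic has a real place, and any
    place works in degree at least 3. *)
Theorem infinite_units_congr1 (K : fieldExtType rat) (M : nat) : (0 < M)%N ->
  ~ is_rational_field K -> ~ imaginary_quadratic K -> infinite_set (@units_congr1 K M).
Proof.
move=> M0 nQ nIQ.
have [t [p [gt mp sp rt Dt]]] := exists_integral_primitive_element K.
set n := \dim {:K} in sp.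
have fr (q : {poly rat}) : (size q <= n)%N -> root (map_poly (in_alg K) q) t -> q = 0.
  move=> sq rq; apply/eqP; apply: contraLR sq => q0; rewrite -ltnNge -sp.
  rewrite -(size_map_poly (in_alg K)).
  have <- : size (minPoly 1 t) = size p.
    by rewrite Dt size_map_poly_id0 // (monicP mp) rmorph1 oner_neq0.
  apply: dvdp_leq; first by rewrite map_poly_eq0.
  by apply: (@minPoly_dvdp _ _ 1%AS) => //; apply/polyOver1P; exists q.
have [rs Drs] := closed_field_poly_normal (map_poly intr p : {poly algC}).
have mpC : map_poly intr p \is @monic algC by rewrite monic_map.
rewrite (monicP mpC) scale1r in Drs.
have urs : uniq rs.
  by rewrite -separable_prod_XsubC -Drs; exact: separable_int_poly Dt.
have srs : size rs = n := size_roots mp sp Drs.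
suff [z zin dz] : exists2 z, z \in rs & (place_degree z < n)%N.
  exact: (infinite_units_congr1_of_place mp sp rt fr urs Drs M0 zin dz).
have n0 : (0 < n)%N by rewrite adim_gt0.
have n1 : n != 1%N.
  apply/eqP => n1; apply: nQ; apply/eqP; rewrite eq_sym eqEdim sub1v dimv1.
  by rewrite -/n n1.
have [n2|n3] := eqVneq n 2.
  have sp3 : size p = 3%N by rewrite sp n2.
  have [z rz Rz] := real_root_of_not_imaginary_quadratic gt mp sp3 rt nIQ.
  exists z; first by rewrite -root_prod_XsubC -Drs.
  by rewrite /place_degree Rz n2.
exists (head 0 rs); first by case: (rs) srs n0 => [<-|z s _ _] //; rewrite mem_head.
apply: (@leq_trans 3); first by rewrite /place_degree; case: ifP.
by case: (n) n0 n1 n3 => [|[|[|m]]].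
Qed.

(** * Divisors in Q and in imaginary quadratic fields *)

Lemma finite_root_set (F : fieldType) (p : {poly F}) : p != 0 ->
  finite_set [set x | root p x].
Proof.
move: {2}(size p) (leqnn (size p)) => k; elim: k p => [|k IH] p.
  by rewrite leqn0 size_poly_eq0 => ->.
move=> sp p0; have [->|/set0P[r rr]] := eqVneq [set x | root p x] set0.
  exact: finite_set0.
have [q Dq] := factor_theorem _ _ rr.
have q0 : q != 0 by apply: contra_neq p0; rewrite Dq => ->; rewrite mul0r.
have /IH/(_ q0) fq : (size q <= k)%N.
  by move: sp; rewrite Dq size_Mmonic ?monicXsubC // size_XsubC addn2.
apply: (@sub_finite_set _ _ ([set x | root q x] `|` [set r])).
  by move=> x /=; rewrite Dq rootM root_XsubC => /orP[|/eqP]; [left|right].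
by rewrite finite_setU; split=> //; exact: finite_set1.
Qed.

(** Z is integrally closed in Q. *)
Lemma rational_algebraic_integer (K : fieldExtType rat) (x : rat) :
  algebraic_integer (x%:A : K) -> x \is a Num.int.
Proof.
case=> q mq rq; rewrite -Cint_rat; apply: Cint_rat_Aint; first exact: Crat_rat.
have rx : root (map_poly intr q : {poly rat}) x.
  rewrite -(fmorph_root (in_alg K)) -map_poly_comp.
  by rewrite (eq_map_poly (g := intr)) // => i /=; rewrite -(rmorph_int (in_alg K)).
apply: (@root_monic_Aint (map_poly intr q)).
- have := rx; rewrite -(fmorph_root (ratr : rat -> algC)) -map_poly_comp.
  by rewrite (eq_map_poly (g := intr)) // => i /=; rewrite ratr_int.
- by rewrite monic_map.
by apply/polyOverP => i; rewrite coef_map /= rpred_int.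
Qed.

Lemma int_as_shifted_ord (T : int) (b : nat) : (`|T| <= b)%N ->
  exists T' : 'I_(2 * b).+1, T = (val T')%:Z - b%:Z :> int.
Proof.
move=> TB; have T8 : (absz (T + b%:Z)%R < (2 * b).+1)%N by lia.
by exists (Ordinal T8) => /=; lia.
Qed.

(** The second hypothesis says that s |-> -s extends to a conjugation of K.  The
    case s = 0, m = 0 covers K = Q.  For a divisor x = u + v s of a, the norm
    u^2 + m v^2 is a natural number k <= B, with B the norm of a, and the trace
    T = 2 u satisfies T^2 <= 4 k; then x is a root of X^2 - T X + k. *)
Lemma finite_divisors (K : fieldExtType rat) (s : K) (m : nat) (a : K) :
  s ^+ 2 = - m%:R ->
  (forall f : {poly rat}, (map_poly (in_alg K) f).[s] = 0 ->
     (map_poly (in_alg K) f).[- s] = 0) ->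
  (forall x : K, exists u v : rat, x = u%:A + v%:A * s) ->
  algebraic_integer a -> a != 0 ->
  finite_set [set x | algebraic_integer x /\ exists2 y, algebraic_integer y & x * y = a].
Proof.
move=> s2 cj co ha a0.
pose F (u v : rat) : {poly rat} := u%:P + v *: 'X.
have FE u v r : (map_poly (in_alg K) (F u v)).[r] = u%:A + v%:A * r.
  by rewrite rmorphD /= map_polyC map_polyZ map_polyX !hornerE.
have integral_conj u v : algebraic_integer (u%:A + v%:A * s) ->
    algebraic_integer (u%:A + v%:A * - s).
  case=> q mq /rootP rq; exists q => //; apply/rootP.
  have e r : (map_poly (in_alg K) (map_poly intr q \Po F u v)).[r] =
             (map_poly intr q).[u%:A + v%:A * r].
    rewrite map_comp_poly horner_comp FE -map_poly_comp.
    by rewrite (eq_map_poly (g := intr)) // => i /=; rewrite -(rmorph_int (in_alg K)).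
  by rewrite -e; apply: cj; rewrite e.
pose N (u v : rat) := u ^+ 2 + m%:R * v ^+ 2.
have NE u v : (N u v)%:A = (u%:A + v%:A * s) * (u%:A + v%:A * - s) :> K.
  have -> : (N u v)%:A = u%:A ^+ 2 + m%:R * v%:A ^+ 2 :> K.
    rewrite -[u%:A]/(in_alg K u) -[v%:A]/(in_alg K v) -!rmorphXn.
    by rewrite -(rmorph_nat (in_alg K)) -rmorphM -rmorphD.
  have -> : m%:R = - s ^+ 2 by rewrite s2 opprK.
  by ring.
have N_ge0 u v : 0 <= N u v by rewrite addr_ge0 ?sqr_ge0 // mulr_ge0 ?sqr_ge0 // ler0n.
have N_nat u v : algebraic_integer (u%:A + v%:A * s) -> exists k : nat, N u v = k%:R.
  move=> h; have /rational_algebraic_integer : algebraic_integer ((N u v)%:A : K).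
    by rewrite NE; apply: algebraic_integerM => //; exact: integral_conj.
  by rewrite intrEge0 // => /natrP.
have T_int u v : algebraic_integer (u%:A + v%:A * s) -> exists k : int, u *+ 2 = k%:~R.
  move=> h; apply/intrP; apply: (@rational_algebraic_integer K).
  have -> : (u *+ 2)%:A = (u%:A + v%:A * s) + (u%:A + v%:A * - s) :> K.
    by rewrite mulrN addrACA subrr addr0 -scalerMnl mulr2n.
  by apply: algebraic_integerD => //; exact: integral_conj.
have [a1 [a2 Da]] := co a.
have [B DB] : exists B : nat, N a1 a2 = B%:R by apply: N_nat; rewrite -Da.
pose Q (T : 'I_(2 * (4 * B)).+1) (k : 'I_B.+1) : {poly K} :=
  'X^2 - ((val T)%:Z - (4 * B)%:Z)%:~R *: 'X + ((k : nat)%:R)%:P.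
apply: (@sub_finite_set _ _ (\bigcup_(i in setT) [set x | root (Q i.1 i.2) x])); last first.
  apply: bigcup_finite => [|[T k] _]; first exact: finite_finset.
  apply: finite_root_set; apply/eqP => /(congr1 (fun f : {poly K} => f`_2)).
  by rewrite !coefE /= mulr0 subr0 addr0 => /eqP; rewrite oner_eq0.
move=> x [hx [y hy xy]].
have [u [v Dx]] := co x; have [u' [v' Dy]] := co y.
rewrite Dx in hx; rewrite Dy in hy.
have xyc : (u%:A + v%:A * - s) * (u'%:A + v'%:A * - s) = a1%:A + a2%:A * - s.
  have e r : (map_poly (in_alg K) (F u v * F u' v' - F a1 a2)).[r] =
     (u%:A + v%:A * r) * (u'%:A + v'%:A * r) - (a1%:A + a2%:A * r).
    by rewrite rmorphB rmorphM /= hornerD hornerN hornerM !FE.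
  by apply/eqP; rewrite -subr_eq0 -e; apply/eqP/cj; rewrite e -Dx -Dy -Da xy subrr.
have NN : N u v * N u' v' = N a1 a2.
  apply: (fmorph_inj (in_alg K)); rewrite rmorphM /= !NE -xyc.
  by rewrite -Dx -Dy -Da -xy mulrACA.
have [k Dk] := N_nat _ _ hx; have [l Dl] := N_nat _ _ hy; have [T DT] := T_int _ _ hx.
have kB : (k <= B)%N.
  have kl : (k * l = B)%N.
    by apply/eqP; rewrite -(eqr_nat rat) natrM -Dk -Dl NN DB.
  have B0 : (0 < B)%N.
    rewrite lt0n; apply: contra_neq a0 => B0.
    have aa : (a1%:A + a2%:A * s) * (a1%:A + a2%:A * - s) = 0 :> K.
      by rewrite -NE DB B0 scale0r.
    move/eqP: aa; rewrite mulf_eq0 -Da => /orP[/eqP//|/eqP e].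
    have := cj (F a1 (- a2)); rewrite !FE !scaleNr !mulrN !mulNr opprK -mulrN.
    by rewrite e -Da; apply.
  by rewrite -kl leq_pmulr //; case: (l) kl B0 => // <-; rewrite muln0.
have T2 : (T ^+ 2 <= (4 * B)%N%:Z).
  rewrite -(ler_int rat) rmorphXn /= -DT.
  apply: (@le_trans _ _ (4 * N u v)).
    rewrite /N mulrDr -[u *+ 2]mulr_natl exprMn -natrX lerDl.
    by apply: mulr_ge0 => //; apply: mulr_ge0; rewrite ?ler0n ?sqr_ge0.
  by rewrite Dk -natrM ler_nat leq_mul2l kB.
have TB : (`|T| <= 4 * B)%N.
  apply: leq_trans (_ : `|T| ^ 2 <= _)%N.
    by case: `|T|%N => // w; rewrite expnS leq_pmulr ?expn1.
  by rewrite -lez_nat -abszX gez0_abs ?sqr_ge0.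
have [T' DT'] := int_as_shifted_ord TB.
have kB' : (k < B.+1)%N by [].
exists (T', Ordinal kB') => //=.
rewrite /root /Q -DT' !hornerE /= Dx.
have <- : (u *+ 2)%:A = T%:~R :> K by rewrite DT -[LHS]/(in_alg K _) rmorph_int.
have <- : (N u v)%:A = k%:R :> K by rewrite Dk -[LHS]/(in_alg K _) rmorph_nat.
rewrite NE -scalerMnl; apply/eqP.
by move: (u%:A) (v%:A) => i j; ring.
Qed.

Lemma finite_divisors_rational (K : fieldExtType rat) (a : K) : is_rational_field K ->
  algebraic_integer a -> a != 0 ->
  finite_set [set x | algebraic_integer x /\ exists2 y, algebraic_integer y & x * y = a].
Proof.
move=> KQ; apply: (@finite_divisors K 0 0).
- by rewrite expr0n oppr0.
- by move=> f; rewrite oppr0.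
move=> x; have : x \in {:K}%VS by rewrite memvf.
by rewrite KQ => /vlineP[u ->]; exists u, 0; rewrite mulr0 addr0.
Qed.

(** Reduction of f modulo X^2 + m. *)
Lemma poly_mod_quadratic (K : fieldExtType rat) (m : nat) (f : {poly rat}) :
  exists u v : rat, forall r : K, r ^+ 2 = - m%:R ->
    (map_poly (in_alg K) f).[r] = u%:A + v%:A * r.
Proof.
pose d : {poly rat} := 'X^2 + (m%:R)%:P.
have sd : size d = 3%N.
  by rewrite size_polyDl ?size_polyXn // (leq_ltn_trans (size_polyC_leq1 _)).
have d0 : d != 0 by rewrite -size_poly_eq0 sd.
exists (f %% d)`_0, (f %% d)`_1 => r r2.
rewrite [in LHS](divp_eq f d) rmorphD rmorphM /= hornerD hornerM.
have -> : (map_poly (in_alg K) d).[r] = 0.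
  rewrite rmorphD /= map_polyXn map_polyC !hornerE r2 /=.
  by rewrite -(rmorph_nat (in_alg K)) addNr.
rewrite mulr0 add0r (@horner_coef_wide _ 2%N).
  by rewrite !big_ord_recl big_ord0 !coef_map /= addr0 expr0 mulr1 expr1.
by rewrite size_map_poly -ltnS -sd ltn_modp.
Qed.

Lemma finite_divisors_imaginary (K : fieldExtType rat) (a : K) : imaginary_quadratic K ->
  algebraic_integer a -> a != 0 ->
  finite_set [set x | algebraic_integer x /\ exists2 y, algebraic_integer y & x * y = a].
Proof.
case=> m [s [m0 s2 gs]]; apply: (@finite_divisors K s m) => //.
  move=> f; have [u [v uv]] := poly_mod_quadratic K m f.
  rewrite !uv ?sqrrN // => e.
  have v0 : v = 0.
    apply/eqP/negPn/negP => v0.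
    have Ds : s = (- u / v)%:A.
      apply: (mulfI (_ : v%:A != 0)); first by rewrite scaler_eq0 negb_or v0 oner_neq0.
      transitivity (- (u%:A) : K); first by apply/eqP; rewrite -addr_eq0 addrC e.
      by rewrite -[RHS]/(in_alg K v * in_alg K (- u / v)) -rmorphM mulrC divfK // rmorphN.
    have : (- u / v) ^+ 2 = - m%:R.
      apply: (fmorph_inj (in_alg K)).
      by rewrite rmorphXn rmorphN rmorph_nat /= -Ds.
    by move/eqP; rewrite eq_sym lt_eqF // (lt_le_trans _ (sqr_ge0 _)) // oppr_lt0 ltr0n.
  by move: e; rewrite v0 !scale0r !mul0r.
move=> x; have : x \in <<1%VS; s>>%VS by rewrite gs memvf.
case/(@Fadjoin_polyP _ _ 1%AS) => _ /polyOver1P[q ->] ->.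
by have [u [v uv]] := poly_mod_quadratic K m q; exists u, v; rewrite uv.
Qed.

(** A nonzero algebraic integer x divides the constant coefficient c of a monic
    integer polynomial that vanishes at x; if c = 0, the polynomial is divisible
    by X and has a quotient of smaller degree. *)
Lemma algebraic_integer_divides_nat (K : fieldExtType rat) (x : K) :
  algebraic_integer x -> x != 0 ->
  exists (M : nat) (y : K), [/\ (0 < M)%N, algebraic_integer y & x * y = M%:R].
Proof.
move=> hx x0; case: (hx) => q; move: {2}(size q) (leqnn (size q)) => k.
elim: k q => [|k IH] q sq mq /rootP qx.
  by move: sq; rewrite leqn0 size_poly_eq0 (negPf (monic_neq0 mq)).
have [r [c Dq]] : exists r c, q = r * 'X + c%:P.
  by elim/poly_ind: (q) => [|r c _]; [exists 0, 0; rewrite mul0r addr0 | exists r, c].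
have int_r : algebraic_integer (map_poly intr r).[x].
  elim/poly_ind: (r) => [|f e IHf]; first rewrite rmorph0 horner0.
    exact: (algebraic_integer_int K 0).
  rewrite rmorphD rmorphM /= map_polyX map_polyC !hornerE.
  apply: algebraic_integerD; last exact: algebraic_integer_int.
  exact: algebraic_integerM.
have rx : (map_poly intr r).[x] * x = - c%:~R.
  move: qx; rewrite Dq rmorphD rmorphM /= map_polyX map_polyC !hornerE.
  by move/eqP; rewrite addr_eq0 => /eqP.
have [c0|c0] := eqVneq c 0.
  apply: (IH r).
  - move: sq; rewrite Dq c0 addr0 size_Mmonic ?monicX ?size_polyX ?addn2 //.
    apply: contraTneq (monic_neq0 mq).
    by rewrite Dq c0 addr0 => ->; rewrite mul0r eqxx.
  - by move: mq; rewrite Dq c0 addr0 monicMr ?monicX.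
  by apply/rootP/eqP; move/eqP: rx; rewrite c0 oppr0 mulf_eq0 (negPf x0) orbF.
exists `|c|%N, ((- sgz c)%:~R * (map_poly intr r).[x]); split.
- by rewrite absz_gt0.
- exact: algebraic_integerM (algebraic_integer_int _ _) _.
rewrite mulrCA [x * _]mulrC rx -[RHS]/((`|c|%N)%:Z%:~R) abszEsg.
by rewrite rmorphN mulrNN -rmorphM.
Qed.

(** * Integral points of the curve *)

Section Curve.
Variables (K : fieldExtType rat) (a b c d : K).

Lemma curve_polyE x y : (curve_poly a b c d).[x, y] =
   c * y ^+ 4 - d * x * y ^+ 3 + b * y ^+ 2 + a.
Proof. by rewrite /curve_poly !hornerE. Qed.

(** If a = 0, then Y^2 divides the polynomial of the curve. *)
Lemma irreducible_curve_a_neq0 : irreducible2 (curve_poly a b c d) -> a != 0.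
Proof.
case=> _ _ irr; apply/eqP => a0.
pose Y : {poly {poly K}} := 'X%:P.
have nuY : Y \isn't a GRing.unit.
  by rewrite poly_unitE size_polyC polyX_eq0 /= coefC /= poly_unitE size_polyX.
pose w' : {poly {poly K}} := c%:P%:P * Y ^+ 2 - d%:P%:P * 'X * Y + b%:P%:P.
case: (irr Y (Y * w')).
- by rewrite /curve_poly a0 !polyC0 addr0 -/Y /w'; ring.
- by rewrite (negPf nuY).
by rewrite unitrM (negPf nuY).
Qed.

(** If d = 0, the polynomial of the curve depends on Y only and has the root y,
    so it is k (Y - y) with k constant; but it has no term of degree 1. *)
Lemma irreducible_curve_d_neq0 x y : irreducible2 (curve_poly a b c d) ->
  (curve_poly a b c d).[x, y] = 0 -> d != 0.
Proof.
case=> _ _ irr; rewrite curve_polyE => e; apply/eqP => d0.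
pose P : {poly K} := c%:P * 'X^4 + b%:P * 'X^2 + a%:P.
have Dp : curve_poly a b c d = P%:P.
  by rewrite /curve_poly d0 !polyC0 !mul0r subr0 /P !(rmorphD, rmorphM, rmorphXn).
have /factor_theorem[Q DQ] : root P y.
  by apply/rootP; rewrite /P !hornerD !hornerCM !hornerXn hornerC -[RHS]e d0; ring.
case: (irr ('X - y%:P)%:P Q%:P).
- by rewrite Dp DQ mulrC rmorphM.
- by rewrite poly_unitE coefC /= poly_unitE size_XsubC andbF.
rewrite poly_unitE coefC /= poly_unitE => /and3P[_ sQ Q0].
have /size_poly1P[k k0 Dk] := sQ.
have : P`_1 = 0 by rewrite /P !coefE /= !mulr0 !addr0.
by rewrite DQ Dk coefCM !coefE /= => /eqP; rewrite subr0 mulr1 (negPf k0).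
Qed.

Hypotheses (ha : algebraic_integer a) (hb : algebraic_integer b)
  (hc : algebraic_integer c) (hd : algebraic_integer d).

(** The ordinate v of a point of the curve divides a and determines its abscissa. *)
Lemma finite_GP_of_finite_divisors : a != 0 -> d != 0 ->
  finite_set [set x | algebraic_integer x /\ exists2 y, algebraic_integer y & x * y = a] ->
  finite_set (GP a b c d).
Proof.
move=> a0 d0 fD.
pose al y := (c * y ^+ 4 + b * y ^+ 2 + a) / (d * y ^+ 3).
apply: sub_finite_set (finite_image (fun y => (al y, al y * y, al y * y ^+ 2)) fD).
move=> [[x y] z] [_ nz [u [v [hu hv xe ye ze]]] e]; subst x y z.
have u0 : u != 0.
  by apply/eqP => u0; apply: nz; rewrite u0 !mul0r.
have e1 : c * v ^+ 4 + b * v ^+ 2 + a = d * u * v ^+ 3.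
  apply: (mulfI (_ : u ^+ 2 != 0)); first by rewrite expf_neq0.
  apply: etrans (_ : d * u * (u * v) * (u * v ^+ 2) = _); last by ring.
  by rewrite -e; ring.
have v0 : v != 0.
  apply: contra_neq a0 => v0; move: e1.
  by rewrite v0 !expr0n /= !mulr0 !add0r.
exists v; last first.
  have -> // : al v = u by rewrite /al e1; field; rewrite d0 v0.
split=> //; exists (d * u * v ^+ 2 - b * v - c * v ^+ 3).
  apply: algebraic_integerB; first apply: algebraic_integerB.
  - by apply: algebraic_integerM; [exact: algebraic_integerM|exact: algebraic_integerX].
  - exact: algebraic_integerM.
  - by apply: algebraic_integerM => //; exact: algebraic_integerX.
have -> : a = d * u * v ^+ 3 - c * v ^+ 4 - b * v ^+ 2 by rewrite -e1; ring.
by ring.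
Qed.

(** The point of ordinate y0 u has an integral abscissa x.  Indeed
    c y0^4 u^4 + b y0^2 u^2 + a = d x0 y0^3 + (u - 1) S with S integral, and
    u - 1 = M w = d y0^3 mu w; it remains to divide by d y0^3 u^3. *)
Lemma GP_of_unit (x0 y0 u mu : K) (M : nat) :
  algebraic_integer x0 -> algebraic_integer y0 -> algebraic_integer mu ->
  c * y0 ^+ 4 - d * x0 * y0 ^+ 3 + b * y0 ^+ 2 + a = 0 ->
  d * y0 ^+ 3 * mu = M%:R -> units_congr1 M u ->
  (c * y0 ^+ 4) * u ^+ 4 + (b * y0 ^+ 2) * u ^+ 2 + a != 0 ->
  exists2 x : K, x != 0 & GP a b c d (x, x * (y0 * u), x * (y0 * u) ^+ 2).
Proof.
move=> hx0 hy0 hmu e EM [u0 hu hu' [w hw Ew]] nz.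
pose S := c * y0 ^+ 4 * (u ^+ 3 + u ^+ 2 + u + 1) + b * y0 ^+ 2 * (u + 1).
pose x := u^-1 ^+ 3 * (x0 + mu * w * S).
have h1 : algebraic_integer (1 : K) by exact: (algebraic_integer_int K 1).
have hx : algebraic_integer x.
  apply: algebraic_integerM; first exact: algebraic_integerX.
  apply: algebraic_integerD => //.
  apply: algebraic_integerM; first exact: algebraic_integerM.
  apply: algebraic_integerD; apply: algebraic_integerM;
    try by apply: algebraic_integerM => //; exact: algebraic_integerX.
  - by do ![apply: algebraic_integerD => //]; exact: algebraic_integerX.
  - exact: algebraic_integerD.
have hy : algebraic_integer (y0 * u) by exact: algebraic_integerM.
have Ex : c * (y0 * u) ^+ 4 + b * (y0 * u) ^+ 2 + a = d * x * (y0 * u) ^+ 3.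
  have -> : d * x * (y0 * u) ^+ 3 = d * x0 * y0 ^+ 3 + (d * y0 ^+ 3 * mu) * w * S.
    by rewrite /x; field.
  rewrite EM -Ew.
  have -> : a = d * x0 * y0 ^+ 3 - c * y0 ^+ 4 - b * y0 ^+ 2.
    by apply/eqP; rewrite -subr_eq0 -[X in _ == X]e; apply/eqP; ring.
  by rewrite /S; ring.
exists x.
  apply: contra_neq nz => x0'; move: Ex; rewrite x0' mulr0 mul0r => <-.
  by ring.
split.
- do !split=> //; first exact: algebraic_integerM.
  by apply: algebraic_integerM => //; exact: algebraic_integerX.
- case=> x0' _ _; move/eqP: nz; apply.
  by move: Ex; rewrite x0' mulr0 mul0r => <-; ring.
- by exists x, (y0 * u).
transitivity (x ^+ 2 * (c * (y0 * u) ^+ 4 + b * (y0 * u) ^+ 2 + a)); first by ring.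
by rewrite Ex; ring.
Qed.

(** The unit u is recovered from the progression, and the condition that the
    abscissa be nonzero excludes only the roots of the nonzero polynomial P. *)
Lemma infinite_GP x0 y0 : a != 0 -> d != 0 ->
  integral_point (curve_poly a b c d) (x0, y0) ->
  (forall M : nat, (0 < M)%N -> infinite_set (@units_congr1 K M)) ->
  infinite_set (GP a b c d).
Proof.
move=> a0 d0 [/= hx0 hy0]; rewrite curve_polyE => e infU finGP.
have y00 : y0 != 0.
  apply: contra_neq a0 => y00; move: e.
  by rewrite y00 !expr0n /= !mulr0 subr0 !add0r.
have [||M [mu [M0 hmu EM]]] := @algebraic_integer_divides_nat K (d * y0 ^+ 3).
- by apply: algebraic_integerM => //; exact: algebraic_integerX.
- by rewrite mulf_neq0 // expf_neq0.
apply: (infU M M0).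
pose P : {poly K} := (c * y0 ^+ 4)%:P * 'X^4 + (b * y0 ^+ 2)%:P * 'X^2 + a%:P.
have P0 : P != 0.
  apply/eqP => /(congr1 (fun f : {poly K} => f`_0)); rewrite /P !coefE /= !mulr0 !add0r.
  by move/eqP; rewrite (negPf a0).
pose g (t : K * K * K) := t.1.2 / t.1.1 / y0.
apply: (@sub_finite_set _ _ ([set u | root P u] `|` g @` GP a b c d)); last first.
  by rewrite finite_setU; split; [exact: finite_root_set | exact: finite_image].
move=> u Uu; have [ru|nru] := boolP (root P u); [by left | right].
move: nru; rewrite /root /P !hornerD !hornerCM !hornerXn hornerC => nz.
have [x x0' GPx] := GP_of_unit hx0 hy0 hmu e EM Uu nz.
exists (x, x * (y0 * u), x * (y0 * u) ^+ 2) => //=.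
by rewrite /g /=; field; rewrite x0' y00.
Qed.
End Curve.

Theorem theorem4p1 (K : fieldExtType rat) (a b c d : K)
    (ha : algebraic_integer a) (hb : algebraic_integer b)
    (hc : algebraic_integer c) (hd : algebraic_integer d)
    (hcurve : irreducible2 (curve_poly a b c d))
    (hpt : exists P : K * K,
       integral_point (curve_poly a b c d) P /\
       nonsingular_at (curve_poly a b c d) P) :
  finite_set (GP a b c d) <-> (is_rational_field K \/ imaginary_quadratic K).
Proof.
have a0 := irreducible_curve_a_neq0 hcurve.
have [[x0 y0] [pt _]] := hpt.
have d0 : d != 0 by case: (pt) => _ _; exact: irreducible_curve_d_neq0.
split=> [finGP | KP].
  apply: contrapT => /not_orP[nQ nIQ].
  apply: infinite_GP finGP => // [|M M0]; first exact: pt.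
  exact: infinite_units_congr1.
apply: finite_GP_of_finite_divisors => //.
case: KP => KP; first exact: finite_divisors_rational.
exact: finite_divisors_imaginary.
Qed.
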